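(* For every integer $n\ge 0$, let $j(n)$ and $k(n)$ denote the $(n+1)$-th smallest element of the sets $\mathcal{J}$ and $\mathcal{K}$, respectively. Then the following hold for every $n\ge 0$: (a) $$j(n)=2n-\left\lfloor\frac{\sqrt{8n+1}-1}{2}\right\rfloor\quad\text{and}\quad H(j(n))=0.$$ (b) $$k(n)=2n+1+\left\lceil\frac{\sqrt{8n+9}-1}{2}\right\rceil\quad\text{and}\quad H(k(n))=1.$$
   Context: $\mathbf{N}=\{0,1,2,\ldots\}$. Every $n\in\mathbf{N}$ is written uniquely as $n=m^2+j$ with $m=\lfloor\sqrt n\rfloor$ and $0\le j\le 2m$; $j=n-\lfloor\sqrt n\rfloor^2$ is called the offset of $n$. Set $\mathcal{J}=\{n\in\mathbf{N}: n-\lfloor\sqrt n\rfloor^2\text{ is even}\}$ and $\mathcal{K}=\{n\in\mathbf{N}: n-\lfloor\sqrt n\rfloor^2\text{ is odd}\}$. Let $F(x;z,w)=\sum_{n=0}^{\infty}x^{n}z^{m}w^{j}\in\mathbf{C}[z,w][[x]]$, where in the $n$-th term $m=\lfloor\sqrt n\rfloor$ and $j=n-m^2$. For $a,b\in\mathbf{C}$, $F(x;a,b)\in\mathbf{C}[[x]]$ is obtained by substituting $z=a$, $w=b$ in each coefficient (with the convention $0^0=1$). Define $G(x)=F(x;1,0)-F(x;1,-1)=\sum_{n=0}^\infty a(n)x^n$, so $a(n)$ is the coefficient of $x^n$ in $G(x)$, and define $H(n)=\sum_{k=0}^{n}a(k)$ for $n\in\mathbf{N}$. *)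

(* Defs.v *)
From mathcomp Require Import all_boot all_order all_algebra polyXY.
From mathcomp Require Import reals.
From mathcomp.real_closed Require Import complex.

Set Implicit Arguments.
Unset Strict Implicit.
Unset Printing Implicit Defensive.

Import Order.TTheory GRing.Theory Num.Theory.

Local Open Scope ring_scope.
Local Open Scope complex_scope.

(* The argument of [Num.truncn] is nonnegative, so truncation is the floor. *)
Definition floor_sqrt (R : realType) (n : nat) : nat :=
  Num.truncn (Num.sqrt (n%:R : R)).

Definition offset (R : realType) (n : nat) : nat :=
  (n - floor_sqrt R n ^ 2)%N.

Definition setJ (R : realType) : pred nat := [pred n | ~~ odd (offset R n)].
Definition setK (R : realType) : pred nat := [pred n | odd (offset R n)].

Definition unbounded (A : pred nat) : Prop :=
  forall m : nat, exists x : nat, (m <= x)%N && A x.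

(* [nth_smallest infA n] is the (n+1)-th smallest element of [A]: the minimum
   of [A] for n = 0, then the least element exceeding the previous one. *)
Fixpoint nth_smallest (A : pred nat) (infA : unbounded A) (n : nat) : nat :=
  if n is p.+1 then ex_minn (infA (nth_smallest infA p).+1)
  else ex_minn (infA 0%N).

Lemma floor_sqrtD (R : realType) (m i : nat) :
  (i <= m.*2)%N -> floor_sqrt R (m ^ 2 + i) = m.
Proof.
move=> le_i; apply: truncn_def.
have sq (p : nat) : p%:R = Num.sqrt ((p ^ 2)%:R : R).
  by rewrite natrX sqrtr_sqr ger0_norm.
rewrite [m%:R]sq [m.+1%:R]sq ler_sqrt // ltr_sqrt ?ltr0n ?expn_gt0 //.
rewrite ler_nat ltr_nat leq_addr /= -[m.+1]addn1 sqrnD muln1 mul2n -addnA ltn_add2l.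
by rewrite exp1n add1n ltnS.
Qed.

Lemma offsetD (R : realType) (m i : nat) :
  (i <= m.*2)%N -> offset R (m ^ 2 + i) = i.
Proof. by move=> le_i; rewrite /offset floor_sqrtD // addKn. Qed.

Lemma setJ_unbounded (R : realType) : unbounded (setJ R).
Proof.
move=> m; exists (m ^ 2 + 0)%N; apply/andP; split.
  by rewrite addn0; case: m => // m; rewrite -mulnn leq_pmulr.
by change (~~ odd (offset R (m ^ 2 + 0))); rewrite offsetD.
Qed.

Lemma setK_unbounded (R : realType) : unbounded (setK R).
Proof.
move=> m; exists (m.+1 ^ 2 + 1)%N; apply/andP; split.
  by rewrite -mulnn addn1 leqW // (leq_trans (leqnSn m)) ?leq_pmulr.
by change (odd (offset R (m.+1 ^ 2 + 1))); rewrite offsetD.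
Qed.

Definition j_ (R : realType) (n : nat) : nat :=
  nth_smallest (@setJ_unbounded R) n.
Definition k_ (R : realType) (n : nat) : nat :=
  nth_smallest (@setK_unbounded R) n.

(* A formal power series in x is represented by its sequence of coefficients.
   The variables z and w of C[z,w] are 'X and 'Y, so that the value of p at
   z = a, w = b is p.[a, b]; note that 0 ^+ 0 = 1. *)
Definition F (R : realType) (n : nat) : {poly {poly R[i]}} :=
  'X ^+ floor_sqrt R n * 'Y ^+ offset R n.

Definition F_at (R : realType) (a b : R[i]) (n : nat) : R[i] := (F R n).[a, b].

Definition G (R : realType) (n : nat) : R[i] := F_at 1 0 n - F_at 1 (- 1) n.

Definition H (R : realType) (n : nat) : R[i] := \sum_(0 <= k < n.+1) G R k.

(* Main.v *)
Require Import Defs.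
From mathcomp Require Import all_boot all_order all_algebra.
From mathcomp Require Import reals.
From mathcomp.real_closed Require Import complex.
From mathcomp Require Import zify lra.

Import Order.TTheory GRing.Theory Num.Theory.

Local Open Scope ring_scope.

(** Cut the natural numbers into blocks, the [m]-th one being
    [m ^ 2 + i] for [0 <= i <= 2 m]; the offset of [m ^ 2 + i] is [i].

    The partial sums.  The coefficient of [G] at [m ^ 2 + i] is
    [(i == 0) - (-1) ^ i]: it vanishes at the start of a block and then
    alternates [1, -1, 1, -1, ...].  A block has an even number [2 m] of these
    alternating terms, so every block sums to zero, and the partial sum [H] at
    [m ^ 2 + i] is the parity of [i] ([H_D]).  Hence [H] is the indicator
    function of the set of numbers with odd offset.

    The enumerations.  Block [m] contains [m + 1] even offsets and [m] odd
    ones, so the numbers of elements of the two sets below [m ^ 2] are the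
    triangular numbers ['C(m.+1, 2)] and ['C(m, 2)] ([count_setJ],
    [count_setK]).  An element of a set is its [n]-th one, counted from zero,
    exactly when [n] elements lie below it ([nth_smallest_count]).  Writing
    [n = 'C(m.+1, 2) + i] with [i <= m], this gives [j(n) = m ^ 2 + 2 i] and
    [k(n) = (m + 1) ^ 2 + 2 i + 1] ([j_E], [k_E]).  Since
    [2 * 'C(m.+1, 2) = m ^ 2 + m], these are [2 n - m] and
    [2 n + 1 + (m + 1)].

    The closed forms.  It remains to read [m] off [n]: as
    [8 * 'C(m.+1, 2) + 1 = (2 m + 1) ^ 2], the triangular root
    [r = (sqrt (8 n + 1) - 1) / 2] satisfies [m <= r < m + 1], and
    [s = (sqrt (8 n + 9) - 1) / 2] satisfies [m < s <= m + 1]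
    ([floor_triangular_root], [ceil_triangular_root]). *)

(** * Induction along the blocks *)

(** The successor of a number either stays in its block or opens the next one;
    this is induction on [m ^ 2 + i] in the coordinates [(m, i)]. *)
Lemma block_ind (P : nat -> nat -> Prop) :
  P 0%N 0%N -> (forall m i, (i < m.*2)%N -> P m i -> P m i.+1) ->
  (forall m, P m m.*2 -> P m.+1 0%N) ->
  forall m i, (i <= m.*2)%N -> P m i.
Proof.
move=> P00 Pnext Pjump m i le_i.
have fill (m' : nat) : P m' 0%N -> forall k, (k <= m'.*2)%N -> P m' k.
  by move=> P0; elim=> // k IHk lt_k; apply: Pnext => //; apply/IHk/ltnW.
apply: (fill) le_i; elim: m => [|m IHm] //.
by apply: Pjump; exact: (fill).
Qed.

Lemma next_square (m : nat) : (m.+1 ^ 2 + 0 = (m ^ 2 + m.*2).+1)%N.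
Proof. lia. Qed.

(** * Enumerating a set by counting *)

Lemma count_iotaS (A : pred nat) (x : nat) :
  count A (iota 0 x.+1) = (count A (iota 0 x) + A x)%N.
Proof. by rewrite -addn1 iotaD count_cat /= addn0. Qed.

(** The number of elements below [x] is strictly monotone on [A], so it
    identifies the elements of [A]; and it grows by exactly one from an element
    to the least one above it, so the [n]-th smallest element has [n] elements
    below it. *)
Lemma nth_smallest_count (A : pred nat) (infA : unbounded A) (n x : nat) :
  A x -> count A (iota 0 x) = n -> nth_smallest infA n = x.
Proof.
have count_lt (y z : nat) : A y -> (y < z)%N ->
    (count A (iota 0 y) < count A (iota 0 z))%N.
  move=> Ay /subnKC <-; rewrite iotaD count_cat count_iotaS Ay addn1.
  exact: leq_addr.
suff [Ay cy] : A (nth_smallest infA n) /\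
    count A (iota 0 (nth_smallest infA n)) = n.
  move=> Ax cx; case: (ltngtP (nth_smallest infA n) x) => // lt_xy.
    by have := count_lt _ _ Ay lt_xy; lia.
  by have := count_lt _ _ Ax lt_xy; lia.
have least_count (p y : nat) : (p <= y)%N ->
    (forall z, (p <= z)%N && A z -> (y <= z)%N) ->
    count A (iota 0 y) = count A (iota 0 p).
  move=> le_py min_y; rewrite -(subnKC le_py) iotaD count_cat add0n.
  apply/eqP; rewrite -[X in _ == X]addn0 eqn_add2l -leqn0 leqNgt -has_count.
  apply/hasPn => z; rewrite mem_iota subnKC // => /andP[le_pz lt_zy].
  by apply/negP => Az; have := min_y z; rewrite le_pz Az => /(_ isT); lia.
elim: n => [|n [An cn]] /=.
  case: ex_minnP => y /= Ay min_y; split=> //.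
  exact: (least_count 0%N).
case: ex_minnP => y /andP[lt_y Ay] min_y; split=> //.
by rewrite (least_count _ _ lt_y min_y) count_iotaS An cn addn1.
Qed.

(** * Triangular numbers *)

Lemma double_triangular (m : nat) : (2 * 'C(m.+1, 2) = m * m.+1)%N.
Proof. by rewrite -mul_bin_diag bin1 mulnC. Qed.

(** Consecutive triangular numbers differ by [m + 1], which leaves room for
    exactly the remainders [0, ..., m]. *)
Lemma triangular_decomposition (n : nat) :
  exists m i, (i <= m)%N /\ n = ('C(m.+1, 2) + i)%N.
Proof.
elim: n => [|n [m [i [le_im ->]]]]; first by exists 0%N, 0%N.
case: (ltnP i m) => [lt_im | le_mi]; first by exists m, i.+1; rewrite addnS.
have -> : i = m by lia.
by exists m.+1, 0%N; rewrite addn0 (binS m.+1 1) bin1 addnS.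
Qed.

Lemma double_triangularR (S : pzSemiRingType) (m : nat) :
  2 * ('C(m.+1, 2))%:R = m%:R * (m%:R + 1) :> S.
Proof. by rewrite -natrM double_triangular natrM -addn1 natrD. Qed.

Lemma le_sqrtr (R : rcfType) (x y : R) :
  0 <= y -> y ^+ 2 <= x -> y <= Num.sqrt x.
Proof. by move=> y0 /ler_wsqrtr; rewrite sqrtr_sqr ger0_norm. Qed.

Lemma sqrtr_le (R : rcfType) (x y : R) :
  0 <= y -> x <= y ^+ 2 -> Num.sqrt x <= y.
Proof. by move=> y0 /ler_wsqrtr; rewrite sqrtr_sqr ger0_norm. Qed.

Lemma lt_sqrtr (R : rcfType) (x y : R) :
  0 <= y -> y ^+ 2 < x -> y < Num.sqrt x.
Proof.
move=> y0 lt_yx; have x0 : 0 < x by apply: le_lt_trans lt_yx; rewrite sqr_ge0.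
by rewrite -[y]ger0_norm // -sqrtr_sqr ltr_sqrt.
Qed.

Lemma sqrtr_lt (R : rcfType) (x y : R) :
  0 < y -> x < y ^+ 2 -> Num.sqrt x < y.
Proof.
move=> y0; rewrite -{2}[y]ger0_norm ?ltW //.
by rewrite -sqrtr_sqr ltr_sqrt ?exprn_gt0.
Qed.

(** For [n = 'C(m.+1, 2) + i] one has [8 n + 1 = (2 m + 1) ^ 2 + 8 i], which
    stays below [(2 m + 3) ^ 2 = (2 m + 1) ^ 2 + 8 (m + 1)] for [i <= m]. *)
Lemma floor_triangular_root (R : realType) (m i : nat) : (i <= m)%N ->
  Num.floor ((Num.sqrt (8 * ('C(m.+1, 2) + i)%:R + 1) - 1) / 2 : R) = m%:Z.
Proof.
move=> le_im; apply: floor_def.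
have T := @double_triangularR R m.
have [m0 i0] : 0 <= m%:R :> R /\ 0 <= i%:R :> R by split.
have im : i%:R <= m%:R :> R by rewrite ler_nat.
have lo : 2 * m%:R + 1 <= Num.sqrt (8 * ('C(m.+1, 2) + i)%:R + 1) :> R.
  by rewrite natrD; apply: le_sqrtr; lra.
have hi : Num.sqrt (8 * ('C(m.+1, 2) + i)%:R + 1) < 2 * m%:R + 3 :> R.
  by rewrite natrD; apply: sqrtr_lt; lra.
by rewrite intrD /= -!pmulrn; apply/andP; split; lra.
Qed.

(** Here [8 n + 9 = (2 m + 1) ^ 2 + 8 (i + 1)] with [1 <= i + 1 <= m + 1]: the
    shift by [8] makes the lower bound strict and lets the upper bound
    [(2 m + 3) ^ 2] be attained, whence a ceiling in place of a floor. *)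
Lemma ceil_triangular_root (R : realType) (m i : nat) : (i <= m)%N ->
  Num.ceil ((Num.sqrt (8 * ('C(m.+1, 2) + i)%:R + 9) - 1) / 2 : R) = m.+1%:Z.
Proof.
move=> le_im; apply: ceil_def.
have T := @double_triangularR R m.
have [m0 i0] : 0 <= m%:R :> R /\ 0 <= i%:R :> R by split.
have im : i%:R <= m%:R :> R by rewrite ler_nat.
have lo : 2 * m%:R + 1 < Num.sqrt (8 * ('C(m.+1, 2) + i)%:R + 9) :> R.
  by rewrite natrD; apply: lt_sqrtr; lra.
have hi : Num.sqrt (8 * ('C(m.+1, 2) + i)%:R + 9) <= 2 * m%:R + 3 :> R.
  by rewrite natrD; apply: sqrtr_le; lra.
have -> : m.+1%:Z = m%:Z + 1 by lia.
by rewrite addrK intrD /= -!pmulrn; apply/andP; split; lra.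
Qed.

(** * The numbers with even and with odd offset *)

Lemma setJD (R : realType) (m i : nat) :
  (i <= m.*2)%N -> setJ R (m ^ 2 + i)%N = ~~ odd i.
Proof. by move=> le_i; rewrite /setJ /= offsetD. Qed.

Lemma setKD (R : realType) (m i : nat) :
  (i <= m.*2)%N -> setK R (m ^ 2 + i)%N = odd i.
Proof. by move=> le_i; rewrite /setK /= offsetD. Qed.

(** The blocks before the [m]-th contribute [1 + 2 + ... + m] even offsets. *)
Lemma count_setJ (R : realType) (m i : nat) : (i <= m.*2)%N ->
  count (setJ R) (iota 0 (m ^ 2 + i)) = ('C(m.+1, 2) + uphalf i)%N.
Proof.
move: m i; apply: block_ind => [//|m i lt_i IH|m IH].
  by rewrite addnS count_iotaS IH setJD 1?ltnW //; lia.
rewrite next_square count_iotaS IH setJD // odd_double.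
by rewrite (binS m.+1 1) bin1; lia.
Qed.

(** The blocks before the [m]-th contribute [0 + 1 + ... + (m - 1)] odd
    offsets. *)
Lemma count_setK (R : realType) (m i : nat) : (i <= m.*2)%N ->
  count (setK R) (iota 0 (m ^ 2 + i)) = ('C(m, 2) + i./2)%N.
Proof.
move: m i; apply: block_ind => [//|m i lt_i IH|m IH].
  by rewrite addnS count_iotaS IH setKD 1?ltnW //; lia.
rewrite next_square count_iotaS IH setKD // odd_double.
by rewrite (binS m 1) bin1; lia.
Qed.

Lemma j_E (R : realType) (m i : nat) : (i <= m)%N ->
  j_ R ('C(m.+1, 2) + i) = (m ^ 2 + i.*2)%N.
Proof.
move=> le_im; apply: nth_smallest_count.
  by rewrite setJD ?odd_double ?leq_double.
by rewrite count_setJ ?leq_double // uphalf_double.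
Qed.

(** The block is [m + 1] and not [m]: block [0] has no odd offset, so the
    enumeration of the odd offsets runs one block ahead of the even ones. *)
Lemma k_E (R : realType) (m i : nat) : (i <= m)%N ->
  k_ R ('C(m.+1, 2) + i) = (m.+1 ^ 2 + i.*2.+1)%N.
Proof.
move=> le_im; have lt_i : (i.*2.+1 <= m.+1.*2)%N by lia.
apply: nth_smallest_count; first by rewrite setKD //= odd_double.
by rewrite count_setK // -[_./2]/(uphalf i.*2) uphalf_double.
Qed.

(** * The partial sums *)

(** The term [(i == 0)] is [0 ^+ i], the value of the monomial at [w = 0]. *)
Lemma G_D (R : realType) (m i : nat) : (i <= m.*2)%N ->
  G R (m ^ 2 + i) = (i == 0%N)%:R - (-1) ^+ odd i.
Proof.
move=> le_i; rewrite /G /F_at /F floor_sqrtD // offsetD //.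
rewrite !hornerM !horner_exp !hornerE !expr1n !mul1r.
by rewrite expr0n signr_odd.
Qed.

(** Inside a block the coefficients alternate [1, -1] and toggle the sum; a
    block ends at the even offset [2 m], where the sum is back to [0], and the
    next block starts with the coefficient [0]. *)
Lemma H_D (R : realType) (m i : nat) :
  (i <= m.*2)%N -> H R (m ^ 2 + i) = (odd i)%:R.
Proof.
have HS (x : nat) : H R x.+1 = H R x + G R x.+1 by rewrite /H big_nat_recr.
move: m i; apply: block_ind => [|m i lt_i IH|m IH].
- by rewrite /H big_nat1 (@G_D R 0 0) // subrr.
- rewrite addnS HS IH -addnS G_D //= sub0r.
  by case: (odd i); rewrite ?expr0 ?expr1 ?opprK ?subrr ?add0r.
- by rewrite next_square HS IH -next_square G_D // odd_double subrr addr0.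
Qed.

Theorem theorem11p1 (R : realType) (n : nat) :
  ((j_ R n)%:Z =
     2 * n%:Z - Num.floor ((Num.sqrt (8 * n%:R + 1) - 1) / 2 : R) /\
   H R (j_ R n) = 0) /\
  ((k_ R n)%:Z =
     2 * n%:Z + 1 + Num.ceil ((Num.sqrt (8 * n%:R + 9) - 1) / 2 : R) /\
   H R (k_ R n) = 1).
Proof.
have [m [i [le_im ->]]] := triangular_decomposition n.
have T := double_triangular m.
rewrite j_E // k_E // floor_triangular_root // ceil_triangular_root //.
split; split.
- by lia.
- by rewrite H_D ?leq_double // odd_double.
- by lia.
- by rewrite H_D ?oddS ?odd_double //; lia.
Qed.
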